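(* For integers $n,k,l\ge 0$ with $3k+2l\le n$, the number $g^{k,l}_n$ of tilings of the honeycomb strip $H_n$ using exactly $k$ trimers, $l$ slanted dimers and $n-3k-2l$ monomers is $$g^{k,l}_n=\binom{n-3k-l}{l}\binom{n-2k-l}{k}.$$
   Context: The honeycomb strip $H_n$ consists of $n$ regular hexagons numbered $1,\dots,n$ arranged in two rows (odd-numbered on the bottom, even-numbered on top), hexagon $i$ sharing an edge with hexagons $i\pm1$ and $i\pm2$. The allowed tiles are: monomers $\{i\}$, slanted dimers $\{i,i+1\}$, and trimers $\{i,i+1,i+2\}$ (horizontal dimers $\{i,i+2\}$ are not allowed); a tiling is a partition of the hexagons of $H_n$ into such tiles. *)

(* Defs.v *)
From mathcomp Require Import all_boot.

Set Implicit Arguments.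
Unset Strict Implicit.
Unset Printing Implicit Defensive.

(* The hexagon numbered i + 1 in the strip H_n is represented by i : 'I_n. *)

Definition monomer n (A : {set 'I_n}) : bool :=
  [exists i : 'I_n, A == [set i]].

Definition slanted_dimer n (A : {set 'I_n}) : bool :=
  [exists i : 'I_n, exists j : 'I_n,
    (j == i.+1 :> nat) && (A == [set i; j])].

Definition trimer n (A : {set 'I_n}) : bool :=
  [exists i : 'I_n, exists j : 'I_n, exists h : 'I_n,
    [&& j == i.+1 :> nat, h == i.+2 :> nat & A == [set i; j; h]]].

Definition allowed_tile n (A : {set 'I_n}) : bool :=
  [|| monomer A, slanted_dimer A | trimer A].

Definition tiling n (P : {set {set 'I_n}}) : bool :=
  partition P [set: 'I_n] && [forall A in P, allowed_tile A].

Definition tilings n k l : {set {set {set 'I_n}}} :=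
  [set P : {set {set 'I_n}} |
    [&& tiling P,
        #|[set A in P | trimer A]| == k,
        #|[set A in P | slanted_dimer A]| == l
      & #|[set A in P | monomer A]| == n - 3 * k - 2 * l]].

Definition g n k l : nat := #|tilings n k l|.

(* Main.v *)
Require Import Defs.
From mathcomp Require Import all_boot.
From mathcomp Require Import zify.

(** Every allowed tile is an interval of 1, 2 or 3 consecutive hexagons.
    Removing the tile that contains the first hexagon leaves a tiling of a
    shorter final segment of the strip, so the tilings of final segments with
    prescribed numbers of tiles of each size obey the recurrence of the
    multinomial coefficients: with [c s] tiles of size [s + 1], there are
    [(\sum_s c s)! / \prod_s (c s)!] of them. *)

Set Implicit Arguments.
Unset Strict Implicit.
Unset Printing Implicit Defensive.

Section Strip.

Variable n : nat.
Implicit Types (A : {set 'I_n}) (P : {set {set 'I_n}}) (c : 'I_3 -> nat).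

(** Positions count from 0. The set is cut off at the end of the strip, so it has [s] elements only
    under a bound such as [a + s <= n]. *)
Definition interval a s : {set 'I_n} := [set i : 'I_n | a <= i < a + s].

Definition final_segment a : {set 'I_n} := [set i : 'I_n | a <= i].

Lemma card_interval a s : a + s <= n -> #|interval a s| = s.
Proof.
elim: s => [|s IHs] asn.
  by apply/eqP; rewrite cards_eq0; apply/eqP/setP => i; rewrite !inE; lia.
have lt_n : a + s < n by lia.
have -> : interval a s.+1 = Ordinal lt_n |: interval a s.
  by apply/setP => i; rewrite !inE -val_eqE /=; lia.
by rewrite cardsU1 IHs ?inE /=; lia.
Qed.

Lemma interval_suffix a s : interval a s :|: final_segment (a + s) = final_segment a.
Proof. by apply/setP => i; rewrite !inE; lia. Qed.

Lemma suffixD_interval a s : final_segment a :\: interval a s = final_segment (a + s).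
Proof. by apply/setP => i; rewrite !inE; lia. Qed.

Lemma disjoint_interval_suffix a s : [disjoint interval a s & final_segment (a + s)].
Proof. by apply/pred0P => i /=; rewrite !inE; lia. Qed.

(** * Allowed tiles as intervals *)

Lemma monomerP A :
  reflect (exists2 a, a + 1 <= n & A = interval a 1) (monomer A).
Proof.
apply: (iffP existsP) => [[i /eqP->]|[a asn ->]].
  exists i; first by have := ltn_ord i; lia.
  by apply/setP => j; rewrite !inE -val_eqE /=; lia.
have lt0 : a < n by lia.
by exists (Ordinal lt0); apply/eqP/setP => j; rewrite !inE -val_eqE /=; lia.
Qed.

Lemma slanted_dimerP A :
  reflect (exists2 a, a + 2 <= n & A = interval a 2) (slanted_dimer A).
Proof.
apply: (iffP existsP) => [[i /existsP[j /andP[/eqP ij /eqP->]]]|[a asn ->]].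
  exists i; first by have := ltn_ord j; lia.
  by apply/setP => x; rewrite !inE -!val_eqE /=; lia.
have lt0 : a < n by lia.
have lt1 : a.+1 < n by lia.
exists (Ordinal lt0); apply/existsP; exists (Ordinal lt1); rewrite eqxx /=.
by apply/eqP/setP => x; rewrite !inE -!val_eqE /=; lia.
Qed.

Lemma trimerP A :
  reflect (exists2 a, a + 3 <= n & A = interval a 3) (trimer A).
Proof.
apply: (iffP existsP) => [[i /existsP[j /existsP[h]]]|[a asn ->]].
  case/and3P=> /eqP ij /eqP ih /eqP->; exists i.
    by have := ltn_ord h; lia.
  by apply/setP => x; rewrite !inE -!val_eqE /=; lia.
have lt0 : a < n by lia.
have lt1 : a.+1 < n by lia.
have lt2 : a.+2 < n by lia.
exists (Ordinal lt0); apply/existsP; exists (Ordinal lt1).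
apply/existsP; exists (Ordinal lt2); rewrite !eqxx /=.
by apply/eqP/setP => x; rewrite !inE -!val_eqE /=; lia.
Qed.

Lemma allowed_tileP A :
  reflect (exists a, exists2 s : 'I_3, a + s.+1 <= n & A = interval a s.+1)
          (allowed_tile A).
Proof.
apply: (iffP or3P) => [|[a [[[|[|[|//]]] lt3] /= asn ->]]].
- case=> [/monomerP|/slanted_dimerP|/trimerP] [a asn ->]; exists a.
  + by exists (@Ordinal 3 0 isT).
  + by exists (@Ordinal 3 1 isT).
  + by exists (@Ordinal 3 2 isT).
- by apply: Or31; apply/monomerP; exists a.
- by apply: Or32; apply/slanted_dimerP; exists a.
- by apply: Or33; apply/trimerP; exists a.
Qed.

(** An interval inside the strip determines its length, so the three kinds of tile exclude each
    other and can be counted by cardinality alone. *)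
Lemma allowed_tile_card A : allowed_tile A ->
  [/\ monomer A = (#|A| == 1), slanted_dimer A = (#|A| == 2)
    & trimer A = (#|A| == 3)].
Proof.
case/allowed_tileP=> a [s asn defA].
have cardA : #|A| = s.+1 by rewrite defA card_interval.
split; rewrite cardA; [apply/monomerP/eqP | apply/slanted_dimerP/eqP
  | apply/trimerP/eqP]; move=> [].
all: try by [move=> b ? defA'; move: cardA; rewrite defA' card_interval].
all: by move=> s_eq; exists a; rewrite ?defA; move: s_eq asn => ->.
Qed.

(** The left end of the interval cannot exceed [a], which it contains, nor be smaller, since no
    hexagon before [a] is available. *)
Lemma allowed_tile_suffix A a (x : 'I_n) :
    x = a :> nat -> allowed_tile A -> x \in A -> A \subset final_segment a ->
  A = interval a #|A|.
Proof.
move=> xa /allowed_tileP[b [s bsn ->]] xA /subsetP sub.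
have ltbn : b < n by lia.
have := sub (Ordinal ltbn); rewrite !inE /= => le_ab.
by move: xA; rewrite inE card_interval // => ?; congr interval; lia.
Qed.

(** * Tilings of final segments, sorted by their first tile *)

Definition tile_count P s := #|[set A in P | #|A| == s]|.

(* Tiles of size [s + 1] are counted by [c s]. *)
Definition suffix_tilings a c : {set {set {set 'I_n}}} :=
  [set P | [&& partition P (final_segment a), [forall A in P, allowed_tile A]
             & [forall s : 'I_3, tile_count P s.+1 == c s]]].

Lemma suffix_tilingsP a c P :
  reflect [/\ partition P (final_segment a), {in P, forall A, allowed_tile A}
            & forall s : 'I_3, tile_count P s.+1 = c s]
          (P \in suffix_tilings a c).
Proof.
rewrite inE; apply: (iffP and3P) => -[partP tileP cntP]; split=> //.
- by move=> A; apply/forall_inP: A.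
- by move=> s; apply/eqP/(forallP cntP).
- exact/forall_inP.
- by apply/forallP => s; apply/eqP.
Qed.

Lemma tile_countU1 A P s : A \notin P ->
  tile_count (A |: P) s = (#|A| == s) + tile_count P s.
Proof.
move=> AP; rewrite /tile_count; case: eqP => [As|/eqP As].
  have -> : [set B in A |: P | #|B| == s] = A |: [set B in P | #|B| == s].
    apply/setP => B; rewrite !inE andb_orl; congr (_ || _).
    by case: (B =P A) => // ->; rewrite As eqxx.
  by rewrite cardsU1 !inE (negbTE AP).
apply: eq_card => B; rewrite !inE andb_orl.
by case: (B =P A) => // ->; rewrite (negbTE As) andbF.
Qed.

(** The subtraction is truncated, so a tile is really removed only when [0 < c s]. *)
Definition remove_one c (s : 'I_3) : 'I_3 -> nat := fun t => c t - (t == s).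

Lemma interval_notin_partition a (s : 'I_3) P : a + s.+1 <= n ->
  partition P (final_segment (a + s.+1)) -> interval a s.+1 \notin P.
Proof.
move=> asn partP; apply/negP => /(partitionS partP)/subsetP sub.
have lt_an : a < n by lia.
have := sub (Ordinal lt_an); rewrite !inE /=; lia.
Qed.

(** The first tile is forced to be [interval a s.+1]; deleting it and putting it back are the two
    inclusions. *)
Lemma suffix_tilings_slice a c (x : 'I_n) (s : 'I_3) :
    x = a :> nat -> a + s.+1 <= n -> 0 < c s ->
  [set P in suffix_tilings a c | #|pblock P x| == s.+1] =
  [set interval a s.+1 |: P | P in suffix_tilings (a + s.+1) (remove_one c s)].
Proof.
move=> xa asn cs; have cardI := card_interval asn.
have xI : x \in interval a s.+1 by rewrite inE; lia.
apply/setP => P; rewrite inE; apply/andP/imsetP => [[]|[Q]].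
  case/suffix_tilingsP=> partP tileP cntP /eqP cardP.
  have xP : x \in cover P by rewrite (cover_partition partP) inE xa.
  have PP := pblock_mem xP.
  have defI : pblock P x = interval a s.+1.
    rewrite -cardP; apply: allowed_tile_suffix xa (tileP _ PP) _ _.
      by rewrite mem_pblock.
    exact: partitionS partP PP.
  rewrite defI in PP.
  exists (P :\ interval a s.+1); last by rewrite setD1K.
  apply/suffix_tilingsP; split=> [|A /setD1P[_ /tileP]//|t].
    by rewrite -suffixD_interval partitionD1.
  (* Only the [P] counted on the right is split into its first tile and the rest. *)
  rewrite /remove_one -cntP -{2}(setD1K PP) tile_countU1 ?setD11 //.
  by rewrite cardI eqSS val_eqE eq_sym addKn.
case/suffix_tilingsP=> partQ allQ cntQ ->.
have IQ := interval_notin_partition asn partQ.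
have partP : partition (interval a s.+1 |: Q) (final_segment a).
  rewrite -(interval_suffix a s.+1) partitionU1 ?disjoint_interval_suffix //.
  by rewrite -card_gt0 cardI.
split; last first.
  by rewrite (def_pblock (partition_trivIset partP) _ xI) ?setU11 ?cardI.
apply/suffix_tilingsP; split=> // [A /setU1P[->|/allQ//]|t].
  by apply/allowed_tileP; exists a, s.
rewrite tile_countU1 // cntQ cardI eqSS val_eqE /remove_one [t == s]eq_sym.
by case: eqP => [<-|_]; lia.
Qed.

Lemma card_suffix_tilings_slice a c (x : 'I_n) (s : 'I_3) :
    x = a :> nat -> a + s.+1 <= n -> 0 < c s ->
  #|[set P in suffix_tilings a c | #|pblock P x| == s.+1]| =
  #|suffix_tilings (a + s.+1) (remove_one c s)|.
Proof.
move=> xa asn cs; rewrite (suffix_tilings_slice xa asn cs) card_in_imset //.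
move=> P Q /suffix_tilingsP[partP _ _] /suffix_tilingsP[partQ _ _] eqPQ.
rewrite -(setU1K (interval_notin_partition asn partP)) eqPQ.
by rewrite setU1K // interval_notin_partition.
Qed.

Lemma card_suffix_tilings_rec a c :
    a + \sum_s c s * s.+1 = n -> 0 < \sum_s c s ->
  #|suffix_tilings a c| =
  \sum_(s | 0 < c s) #|suffix_tilings (a + s.+1) (remove_one c s)|.
Proof.
move=> sum_n c_gt0.
have asn (s : 'I_3) : 0 < c s -> a + s.+1 <= n.
  by move=> cs; rewrite -sum_n (bigD1 s) //=; nia.
have lt_an : a < n.
  (* Some tile remains to be placed, and it needs room after [a]; hence hexagon [a] exists. *)
  case: (pickP (fun s => 0 < c s)) => [s /asn|c0]; first by lia.
  by move: c_gt0; rewrite big1 // => s _; move: (c0 s); lia.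
pose x := Ordinal lt_an.
have block P : P \in suffix_tilings a c ->
    exists2 s : 'I_3, 0 < c s & #|pblock P x| = s.+1.
  case/suffix_tilingsP=> partP tileP cntP.
  have xP : x \in cover P by rewrite (cover_partition partP) inE.
  have PP := pblock_mem xP.
  have /allowed_tileP[b [s bsn defB]] := tileP _ PP.
  exists s; last by rewrite defB card_interval.
  rewrite -cntP card_gt0; apply/set0Pn; exists (pblock P x).
  by rewrite inE PP defB card_interval /=.
transitivity (\sum_(s | 0 < c s)
    #|[set P in suffix_tilings a c | #|pblock P x| == s.+1]|); last first.
  by apply: eq_bigr => s cs; rewrite card_suffix_tilings_slice ?asn.
(* The tile containing [x] has 1, 2 or 3 hexagons, so [inord] never falls back on its default value
   here. *)
rewrite -sum1_card (partition_big (fun P => inord (#|pblock P x|.-1) : 'I_3)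
  (fun s => 0 < c s)) => [|P /block[s cs ->]] /=; last by rewrite inord_val.
apply: eq_bigr => s cs; rewrite -sum1_card; apply: eq_bigl => P; rewrite inE.
apply: andb_id2l => /block[t _ ->]; rewrite /= inord_val eqSS.
by rewrite -val_eqE.
Qed.

(** The multinomial formula is stated without division. Induction on the number of tiles reduces it
    to the identity [m.+1]! = \sum_s c s * m[!], matched term by term with the recurrence. *)
Lemma card_suffix_tilings a c : a + \sum_s c s * s.+1 = n ->
  #|suffix_tilings a c| * \prod_s (c s)`! = (\sum_s c s)`!.
Proof.
move def_m: (\sum_s c s) => m; elim: m a c def_m => [|m IHm] a c def_m sum_n.
  have c0 s : c s = 0.
    by apply/eqP; move/eqP: def_m; rewrite sum_nat_eq0 => /forallP/(_ s).
  have an : a = n by move: sum_n; rewrite big1 ?addn0 // => s _; rewrite c0.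
  rewrite big1 => [|s _]; last by rewrite c0.
  (* With no tiles left the segment is empty, and its only tiling is the empty one. *)
  rewrite muln1; apply/eqP/cards1P; exists set0; apply/setP => P.
  have suf0 : final_segment a = set0.
    by apply/setP => i; rewrite !inE an; have := ltn_ord i; lia.
  rewrite [RHS]inE; apply/suffix_tilingsP/eqP; rewrite suf0 partition_set0.
    by case=> /eqP.
  move=> ->; split=> // [A|s]; first by rewrite inE.
  by rewrite c0; apply/eqP; rewrite cards_eq0; apply/eqP/setP => A; rewrite !inE.
rewrite card_suffix_tilings_rec ?def_m // big_distrl /= factS -[in RHS]def_m.
rewrite big_distrl /= [RHS](bigID (fun s => 0 < c s)) /=.
(* Sizes with [c s = 0] add nothing to the factorial side, so both sums run over the same sizes. *)
rewrite [X in _ = _ + X]big1 ?addn0 => [|s]; last by rewrite -eqn0Ngt => /eqP->.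
apply: eq_bigr => s cs.
have others t : t != s -> remove_one c s t = c t.
  by rewrite /remove_one => /negbTE->; rewrite subn0.
have self : c s = (remove_one c s s).+1 by rewrite /remove_one eqxx; lia.
have sum_m : \sum_t remove_one c s t = m.
  apply: succn_inj; rewrite -def_m (bigD1 s) //= [RHS](bigD1 s) //= self.
  by rewrite (eq_bigr _ others).
rewrite -(IHm (a + s.+1) (remove_one c s)) //; last first.
  rewrite -sum_n (bigD1 s) //= [in RHS](bigD1 s) //= self.
  by rewrite (eq_bigr (fun t => c t * t.+1)) => [|t /others->//]; lia.
(* Lowering [c s] by one divides the product of factorials by exactly [c s]. *)
rewrite [in LHS](bigD1 s) // [in RHS](bigD1 s) //= self factS.
rewrite [in RHS](eq_bigr (fun t => (c t)`!)) => [|t /others->//].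
by rewrite -mulnA mulnCA.
Qed.

End Strip.

Theorem theorem12 (n k l : nat) (hkl : 3 * k + 2 * l <= n) :
  g n k l = 'C(n - 3 * k - l, l) * 'C(n - 2 * k - l, k).
Proof.
pose m := n - 3 * k - 2 * l.
(* Index [s] stands for size [s + 1]: monomers, dimers, trimers in this order. *)
pose c (s : 'I_3) := nth 0 [:: m; l; k] s.
have -> : g n k l = #|suffix_tilings n 0 c|.
  apply: eq_card => P; rewrite !inE /tiling -andbA.
  have -> : final_segment n 0 = [set: 'I_n] by apply/setP => i; rewrite !inE.
  apply: andb_id2l => _; apply: andb_id2l => /forall_inP tileP.
  have cnt (p : pred {set 'I_n}) s :
      {in P, forall A, p A = (#|A| == s)} ->
    #|[set A in P | p A]| = tile_count P s.
    by move=> eqp; apply: eq_card => A; rewrite !inE; apply: andb_id2l => /eqp.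
  rewrite (cnt _ 3) => [|A /tileP/allowed_tile_card[]//].
  rewrite (cnt _ 2) => [|A /tileP/allowed_tile_card[]//].
  rewrite (cnt _ 1) => [|A /tileP/allowed_tile_card[]//].
  apply/and3P/forallP => [[c3 c2 c1] [[|[|[|//]]] lt3]//|cP].
  by split; [apply: (cP (@Ordinal 3 2 isT)) | apply: (cP (@Ordinal 3 1 isT))
    | apply: (cP (@Ordinal 3 0 isT))].
have := @card_suffix_tilings n 0 c.
rewrite !big_ord_recr !big_ord0 /= /c /= => /(_ ltac:(lia)) card_c.
have e1 : n - 3 * k - l = m + l by lia.
have e2 : n - 2 * k - l = m + l + k by lia.
(* The multinomial coefficient of [m], [l], [k] splits into two binomials: choose the trimers among
   all [m + l + k] tiles, then the dimers among the other [m + l]. *)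
have := bin_fact (leq_addl m l); have := bin_fact (leq_addl (m + l) k).
rewrite !addnK e1 e2 => binN binM.
apply/eqP; rewrite -(eqn_pmul2r (fact_gt0 k)) -(eqn_pmul2r (fact_gt0 l)).
rewrite -(eqn_pmul2r (fact_gt0 m)); apply/eqP.
by move: card_c binN; rewrite -binM !add0n mul1n; nia.
Qed.
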